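(* Let $K,L$ be star bodies about the origin in $\mathbb{R}^n$ and let $p\ge1$. If $\varphi(x)=\|x\|_K^p$, $\psi(x)=\|x\|_L^p$, $f=e^{-\varphi}$ and $g=e^{-\psi}$, then $$J(f)=\Gamma\left(1+\tfrac np\right)V(K)$$ and $$\widehat{\delta J}(f,g)=\frac np\,\Gamma\left(1+\tfrac np\right)\widetilde V_{-p}(K,L).$$
   Context: A star body (about the origin) is a compact set $K\subset\mathbb{R}^n$, star-shaped about the origin, whose radial function $\rho_K(x)=\max\{t\ge0:tx\in K\}$ ($x\neq0$) is positive and continuous. Its Minkowski functional is $\|x\|_K=\rho_K(x)^{-1}$ for $x\ne0$ and $\|0\|_K=0$. $V$ is $n$-dimensional volume, $J(f)=\int_{\mathbb{R}^n}f\,dx$. For $p\ge1$ and $t>0$, $K\widehat{+}_p t\diamond L$ is the star body with $\rho(K\widehat{+}_p t\diamond L,\cdot)^{-p}=\rho_K^{-p}+t\rho_L^{-p}$, and the $L_p$ dual mixed volume is $$\widetilde V_{-p}(K,L)=-\frac pn\lim_{t\to0^+}\frac{V(K\widehat{+}_p t\diamond L)-V(K)}{t}=\frac1n\int_{S^{n-1}}\rho_K^{n+p}(u)\rho_L^{-p}(u)\,du.$$ For $f=e^{-\varphi}$, $g=e^{-\psi}$ integrable, $\widehat{\delta J}(f,g)=-\lim_{t\to0^+}\frac{J(e^{-(\varphi+t\psi)})-J(f)}{t}$. *)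

(* Defs.v *)
From HB Require Import structures.
From mathcomp Require Import all_boot all_order all_algebra.
From mathcomp Require Import all_classical all_reals all_analysis.
From mathcomp Require Import measurable_realfun.

Set Implicit Arguments.
Unset Strict Implicit.
Unset Printing Implicit Defensive.

Import Order.TTheory GRing.Theory Num.Theory.
Import numFieldNormedType.Exports.

Local Open Scope classical_set_scope.
Local Open Scope ring_scope.

Definition borel_rV (R : realType) (n : nat) :=
  g_sigma_algebraType (@open 'rV[R]_n).

Lemma measurable_fun_rV d (T : measurableType d) (R : realType) (n : nat)
    (f : T -> borel_rV R n) :
  (forall i, measurable_fun setT (fun x => (f x : 'rV[R]_n) ord0 i)) ->
  measurable_fun setT f.
Proof.
move=> mf; apply: (@measurability _ _ T (borel_rV R n) _ _ (@open 'rV[R]_n)) => [//|].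
move=> _ [U oU <-]; rewrite setTI.
pose B (z : 'rV[rat]_n * nat) : set 'rV[R]_n :=
  [set y | forall i, `|y ord0 i - ratr (z.1 ord0 i)| < z.2.+1%:R^-1].
have -> : f @^-1` U = \bigcup_(z in [set z | B z `<=` U]) (f @^-1` B z).
  apply/seteqP; split => [x Ux|x [z /= zU]]; last exact: zU.
  have /nbhs_ballP[e /= e0 eU] := open_nbhs_nbhs (conj oU Ux).
  pose k := Num.truncn (2 / e).
  have k2 : 2 * k.+1%:R^-1 < e.
    rewrite ltr_pdivrMr// mulrC -ltr_pdivrMr// truncnS_gt//.
  have /choice[q hq] (i : 'I_n) :
      exists q : rat, `|(f x : 'rV[R]_n) ord0 i - ratr q| < k.+1%:R^-1.
    have [|q] := @rat_in_itvoo R ((f x : 'rV[R]_n) ord0 i - k.+1%:R^-1)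
      ((f x : 'rV[R]_n) ord0 i + k.+1%:R^-1).
      by rewrite ltrBlDr -addrA ltrDl addr_gt0.
    by rewrite in_itv/= -ltr_distlC => hq; exists q.
  exists (\row_i q i, k) => /=; last by move=> i; rewrite mxE.
  move=> y By; apply: eU; split=> // i j; rewrite (ord1 i) /ball/=.
  apply: le_lt_trans k2.
  rewrite (_ : _ - _ = ((f x : 'rV[R]_n) ord0 j - ratr (q j))
    - (y ord0 j - ratr (q j))); last by rewrite opprB addrA addrNK.
  rewrite (le_trans (ler_normB _ _))// mulrDl mul1r lerD ?ltW//.
  by have := By j; rewrite /= mxE.
rewrite bigcup_mkcond; apply: countable_bigcupT_measurable => // z.
case: ifP => // _.
have -> : f @^-1` B z = \bigcap_(i in [set: 'I_n])
    ((fun x => (f x : 'rV[R]_n) ord0 i) @^-1`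
      ball (ratr (z.1 ord0 i) : R) z.2.+1%:R^-1).
  apply/seteqP; split => [x Bx i _|x Bx i]; rewrite /ball/=.
    by rewrite distrC; exact: Bx.
  by rewrite distrC; exact: Bx.
apply: fin_bigcap_measurable => // i _.
by rewrite -[X in measurable X]setTI; apply: mf => //; exact: measurable_ball.
Qed.

Lemma continuous_measurable_rV (R : realType) (n : nat) (f : 'rV[R]_n -> R) :
  continuous f -> measurable_fun setT (f : borel_rV R n -> R).
Proof.
move=> /continuousP cf; apply: (@measurability _ _ (borel_rV R n) R setT f _ (RGenOInfty.measurableE R)).
move=> _ [_ [x ->] <-]; rewrite setTI.
by apply: sub_gen_smallest; apply: cf; exact: interval_open.
Qed.

Definition cons_rV (R : realType) (n : nat) (z : borel_rV R n * measurableTypeR R) :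
  borel_rV R n.+1 := row_mx (const_mx z.2 : 'rV[R]_1) z.1.

Lemma cons_rV0 (R : realType) (n : nat) (z : borel_rV R n * measurableTypeR R) :
  (cons_rV z : 'rV[R]_n.+1) ord0 ord0 = z.2.
Proof.
have e : ord0 = lshift n ord0 :> 'I_(1 + n) by exact/val_inj.
transitivity (row_mx (const_mx z.2 : 'rV[R]_1) (z.1 : 'rV[R]_n) ord0
  (lshift n ord0)); first by rewrite -e.
by rewrite row_mxEl mxE.
Qed.

Lemma cons_rVS (R : realType) (n : nat) (z : borel_rV R n * measurableTypeR R)
    (k : 'I_n) :
  (cons_rV z : 'rV[R]_n.+1) ord0 (lift ord0 k) = (z.1 : 'rV[R]_n) ord0 k.
Proof.
have e : lift ord0 k = rshift 1 k :> 'I_(1 + n) by exact/val_inj.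
transitivity (row_mx (const_mx z.2 : 'rV[R]_1) (z.1 : 'rV[R]_n) ord0
  (rshift 1 k)); first by rewrite -e.
by rewrite row_mxEr.
Qed.

Lemma measurable_cons_rV (R : realType) (n : nat) :
  measurable_fun setT (@cons_rV R n).
Proof.
apply: measurable_fun_rV => i; case: (unliftP ord0 i) => [k ->|->].
- under eq_fun do rewrite cons_rVS.
  apply: (@measurableT_comp _ _ _ _ _ _
    (fun v : borel_rV R n => (v : 'rV[R]_n) ord0 k)).
    by apply: continuous_measurable_rV; exact: coord_continuous.
  exact: measurable_fst.
- by under eq_fun do rewrite cons_rV0; exact: measurable_snd.
Qed.

Section cons_measure.
Local Open Scope ereal_scope.
Context (R : realType) (n : nat) (mu : {measure set (borel_rV R n) -> \bar R}).

Definition cons_measure : set (borel_rV R n.+1) -> \bar R :=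
  pushforward (mu \x lebesgue_measure) (@cons_rV R n).

Let cons_measure0 : cons_measure set0 = 0.
Proof.
rewrite /cons_measure /pushforward preimage_set0.
exact: (measure0 (mu \x lebesgue_measure)).
Qed.

Let cons_measure_ge0 A : 0 <= cons_measure A.
Proof. exact: (measure_ge0 (mu \x lebesgue_measure)). Qed.

Let cons_measure_sigma_additive : semi_sigma_additive cons_measure.
Proof.
have mf := @measurable_cons_rV R n.
pose m : {measure set (borel_rV R n * measurableTypeR R) -> \bar R} := mu \x lebesgue_measure.
move=> F mF tF mUF; rewrite /cons_measure /pushforward preimage_bigcup.
apply: (@measure_semi_sigma_additive _ _ _ m (fun k => @cons_rV R n @^-1` F k)).
- by move=> k; rewrite -[X in measurable X]setTI; exact: mf.
- apply/trivIsetP => /= i j _ _ ij; rewrite -preimage_setI.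
  by move/trivIsetP : tF => /(_ _ _ _ _ ij) ->//; rewrite preimage_set0.
- by rewrite -preimage_bigcup -[X in measurable X]setTI; exact: mf.
Qed.

HB.instance Definition _ := isMeasure.Build _ _ _ cons_measure
  cons_measure0 cons_measure_ge0 cons_measure_sigma_additive.

End cons_measure.

(* The n-fold product of the Lebesgue measure (see [lebesgue_rV_box]). *)
Fixpoint lebesgue_rV (R : realType) (n : nat) :
    {measure set (borel_rV R n) -> \bar R} :=
  match n with
  | 0%N => dirac ((0 : 'rV[R]_0) : borel_rV R 0)
  | m.+1 => cons_measure (lebesgue_rV R m)
  end.

Lemma lebesgue_rV_box (R : realType) (n : nat) (A : 'I_n -> set R) :
  (forall i, measurable (A i)) ->
  lebesgue_rV R n [set v | forall i, A i ((v : 'rV[R]_n) ord0 i)] =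
  (\prod_(i < n) lebesgue_measure (A i))%E.
Proof.
elim: n A => [|n IH] A mA.
  rewrite big_ord0 (_ : mkset _ = [set: borel_rV R 0]); first exact: diracT.
  by apply/seteqP; split => // v _ [].
rewrite big_ord_recl /= /cons_measure /pushforward.
rewrite (_ : _ @^-1` _ = [set v : borel_rV R n | forall i,
    A (lift ord0 i) ((v : 'rV[R]_n) ord0 i)] `*` A ord0); last first.
  apply/seteqP; split => [z /= Az|z /= [zA zA0] i].
    split => [i|].
      by have := Az (lift ord0 i); rewrite cons_rVS.
    by have := Az ord0; rewrite cons_rV0.
  by case: (unliftP ord0 i) => [k ->|->]; rewrite ?cons_rVS ?cons_rV0.
transitivity ((lebesgue_rV R n [set v : borel_rV R n | forall i,
    A (lift ord0 i) ((v : 'rV[R]_n) ord0 i)]) * lebesgue_measure (A ord0))%E.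
  apply: product_measure1E; last exact: mA.
  rewrite (_ : mkset _ = \bigcap_(i in [set: 'I_n])
      ((fun v : borel_rV R n => (v : 'rV[R]_n) ord0 i) @^-1` A (lift ord0 i))).
    apply: fin_bigcap_measurable => // i _.
    rewrite -[X in measurable X]setTI; apply: continuous_measurable_rV => //.
    exact: coord_continuous.
  by apply/seteqP; split => [v vA i _|v vA i]; exact: vA.
rewrite muleC; congr (_ * _)%E.
by apply: (IH (fun i => A (lift ord0 i))) => i; exact: mA.
Qed.

Section star_bodies.
Context (R : realType) (n : nat).
Implicit Types (K L : set 'rV[R]_n) (f g : 'rV[R]_n -> R) (p t : R).

Definition volume K : R := fine (lebesgue_rV R n K).

Definition J f : R := \int[lebesgue_rV R n]_x f x.

(* For [x != 0] and [K] a star body the supremum is a maximum (see [radialP]);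
   the value at [x = 0] is meaningless and never used. *)
Definition radial K (x : 'rV[R]_n) : R := sup [set t | 0 <= t /\ K (t *: x)].

Definition star_body K :=
  [/\ compact K,
      forall x t, K x -> 0 <= t <= 1 -> K (t *: x) &
      forall x, x != 0 -> 0 < radial K x /\ {for x, continuous (radial K)}].

Lemma radialP K x t : star_body K -> x != 0 -> 0 <= t ->
  K (t *: x) <-> t <= radial K x.
Proof.
move=> [cK sK rK] x0 t0; pose S := [set t | 0 <= t /\ K (t *: x)].
have [k Kk] : S !=set0.
  apply: contrapT => /set0P/negP; rewrite negbK => /eqP S0.
  by have [] := rK _ x0; rewrite /radial -/S S0 sup0 ltxx.
have hS : has_sup S.
  split; first by exists k.
  have [M [_ hM]] := compact_bounded cK.
  exists ((M + 1) / `|x|) => s [s0 Ksx].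
  have /(_ _ Ksx)/= := hM (M + 1) (ltr_pwDr ltr01 (lexx M)).
  by rewrite normrZ ger0_norm// ler_pdivlMr ?normr_gt0.
split=> [Ktx|]; first by apply: ub_le_sup; [exact: hS.2|split].
have down s u : 0 <= u -> u <= s -> K (s *: x) -> K (u *: x).
  move=> u0 us Ks; have [s0|s0] := eqVneq s 0.
    by rewrite (_ : u = s)//; apply/eqP; rewrite eq_le us s0.
  have s1 : 0 < s by rewrite lt_neqAle eq_sym s0 (le_trans u0 us).
  rewrite -[u](divfK s0) -scalerA; apply: sK => //.
  by rewrite divr_ge0 ?(ltW s1)//= ler_pdivrMr// mul1r.
have lt_rad s : 0 <= s -> s < radial K x -> K (s *: x).
  move=> s0 /(sup_gt (ex_intro _ k Kk))[u [u0 Ku] su].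
  exact: down (ltW su) Ku.
rewrite le_eqVlt => /predU1P[tr|]; last exact: lt_rad.
have clK : closed K by apply: compact_closed => //; exact: norm_hausdorff.
have tpos : 0 < t by rewrite tr; case: (rK _ x0).
apply: (@closed_cvg _ _ (t^'-) _ (fun s => s *: x) K) => //.
  near=> s; apply: lt_rad.
    by near: s; exact: nbhs_left_ge.
  by rewrite -tr; near: s; exact: nbhs_left_lt.
apply: cvg_at_left_filter.
by apply: cvgZr_tmp; exact: cvg_id.
Unshelve. all: by end_near. Qed.

Lemma radial_eq K x r : 0 <= r ->
  (forall t, 0 <= t -> K (t *: x) <-> t <= r) -> radial K x = r.
Proof.
move=> r0 Kr; rewrite /radial.
rewrite (_ : [set t | _] = `[0, r]%classic); first exact: sup_itvcc.
apply/seteqP; split => t /=; rewrite in_itv/=.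
  by move=> [t0 Kt]; rewrite t0; apply/Kr.
by move=> /andP[t0 tr]; split => //; apply/Kr.
Qed.

Definition minkowski_functional K (x : 'rV[R]_n) : R :=
  if x == 0 then 0 else (radial K x)^-1.

(* A star body [M] is determined by its radial function: it consists of [0] and
   of the [x != 0] with [1 <= radial M x], i.e., [radial M x `^ (- p) <= 1].
   That this is the star body with the intended radial function is
   [dual_Lp_sum_star_body] and [dual_Lp_sum_radial]. *)
Definition dual_Lp_sum p K t L : set 'rV[R]_n :=
  [set x | x = 0 \/
    (x != 0 /\ radial K x `^ (- p) + t * radial L x `^ (- p) <= 1)].

Section dual_Lp_sum_star_body.
Variables (K L : set 'rV[R]_n) (p t : R).
Hypotheses (starK : star_body K) (starL : star_body L).
Hypotheses (p_ge1 : 1 <= p) (t_ge0 : 0 <= t).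

Let S x := radial K x `^ (- p) + t * radial L x `^ (- p).

Let p_gt0 : 0 < p. Proof. exact: lt_le_trans p_ge1. Qed.

Let radial_gt0 M x : star_body M -> x != 0 -> 0 < radial M x.
Proof. by move=> [_ _ rM] /rM[]. Qed.

Let radialZ M x c : star_body M -> x != 0 -> 0 < c ->
  radial M (c *: x) = radial M x / c.
Proof.
move=> sM x0 c0; apply: radial_eq => [|s s0].
  by rewrite divr_ge0 ?ltW// radial_gt0.
by rewrite scalerA ler_pdivlMr//; apply: radialP => //; rewrite mulr_ge0// ltW.
Qed.

Let S_gt0 x : x != 0 -> 0 < S x.
Proof.
move=> x0; apply: ltr_pwDl; first by rewrite powR_gt0// radial_gt0.
by rewrite mulr_ge0// powR_ge0.
Qed.

Let powN_div a c : 0 < a -> 0 < c -> (a / c) `^ (- p) = c `^ p * a `^ (- p).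
Proof.
move=> a0 c0; rewrite powRM ?invr_ge0 ?ltW// mulrC; congr (_ * _).
by rewrite -powR_inv1 ?ltW// -powRrM mulN1r opprK.
Qed.

Let SZ x c : x != 0 -> 0 < c -> S (c *: x) = c `^ p * S x.
Proof.
move=> x0 c0; rewrite /S !radialZ// !powN_div ?radial_gt0//.
by rewrite mulrDr mulrCA.
Qed.

Let radial_sum x : x != 0 ->
  radial (dual_Lp_sum p K t L) x = S x `^ (- p^-1).
Proof.
move=> x0; apply: radial_eq => [|s s0]; first exact: powR_ge0.
have [->|sn0] := eqVneq s 0.
  by rewrite scale0r powR_ge0; split => // _; left.
have {s0} s_gt0 : 0 < s by rewrite lt_neqAle eq_sym sn0.
have E : (S (s *: x) <= 1) = (s <= S x `^ (- p^-1)).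
  rewrite SZ// -[RHS](le_mono_in (gt0_ltr_powR p_gt0))
    ?nnegrE ?powR_ge0 ?(ltW s_gt0)//=.
  rewrite -[in RHS]powRrM mulNr mulVf ?gt_eqF// powR_inv1 ?(ltW (S_gt0 x0))//.
  by rewrite -[_^-1]mul1r ler_pdivlMr// S_gt0.
rewrite -E; split => [[/eqP|[]//]|?]; last first.
  by right; split => //; rewrite scaler_eq0 negb_or sn0.
by rewrite scaler_eq0 (negPf sn0) (negPf x0).
Qed.

Lemma dual_Lp_sum_radial x : x != 0 ->
  radial (dual_Lp_sum p K t L) x `^ (- p) =
  radial K x `^ (- p) + t * radial L x `^ (- p).
Proof.
move=> x0; rewrite radial_sum// -powRrM mulrNN mulVf ?gt_eqF// powRr1//.
exact/ltW/S_gt0.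
Qed.

Let S_continuous x : x != 0 -> {for x, continuous S}.
Proof.
move=> x0.
have cpow M : star_body M ->
    {for x, continuous (fun y => radial M y `^ (- p))}.
  move=> sM; apply: (@continuous_comp _ _ _ (radial M) (@powR R ^~ (- p))).
    by case: sM => _ _ /(_ _ x0)[].
  apply/differentiable_continuous/derivable1_diffP/derivable_powR.
  by rewrite in_itv/= andbT radial_gt0.
have ct : {for x, continuous (fun _ : 'rV[R]_n => t)} by apply: cst_continuous.
exact: (continuousD (cpow K starK) (continuousM ct (cpow L starL))).
Qed.

Let neq0_nbhs (x : 'rV[R]_n) : x != 0 -> \forall y \near x, y != 0.
Proof.
move=> x0; near=> y; apply/negP => /eqP y0.
have : `|x - y| < `|x|.
  by near: y; apply: cvgr_dist_lt; rewrite ?normr_gt0//; exact: cvg_id.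
by rewrite y0 subr0 ltxx.
Unshelve. all: by end_near. Qed.

Lemma dual_Lp_sum_star_body : star_body (dual_Lp_sum p K t L).
Proof.
have p1 : 1 `^ p = 1 :> R by rewrite powR1.
have memP x : x != 0 -> dual_Lp_sum p K t L x <-> S x <= 1.
  move=> x0; split=> [[/eqP|[]//]|]; first by rewrite (negPf x0).
  by move=> Sx; right.
split.
- have [cK _ _] := starK.
  apply: bounded_closed_compact.
    have [M [Mr hM]] := compact_bounded cK.
    exists (Num.max M 0); split; first by rewrite num_real.
    move=> y; rewrite gt_max => /andP[/hM yM y0] x /= [->|[x0 Sx]].
      by rewrite normr0 ltW.
    apply: yM; rewrite -[x]scale1r; apply/radialP => //.
    rewrite leNgt; apply/negP => rad1.
    suff : 1 < S x by rewrite ltNge Sx.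
    rewrite ltr_wpDr ?mulr_ge0 ?powR_ge0// powRN invf_gt1.
      by rewrite -[ltRHS]p1 gt0_ltr_powR ?nnegrE// ltW// radial_gt0.
    by rewrite powR_gt0// radial_gt0.
  rewrite -[X in closed X]setCK; apply: open_closedC; rewrite openE => x xM.
  have x0 : x != 0 by apply: contra_notN xM => /eqP; left.
  have Sx : 1 < S x by rewrite ltNge; apply/negP => /(memP _ x0).
  have : \forall y \near x, 1 < S y.
    exact: (cvgr_gt (S x) (S_continuous x0)).
  apply: filterS2 (neq0_nbhs x0) => y y0 Sy.
  by move/(memP _ y0); rewrite leNgt Sy.
- move=> x s [->|[x0 Sx]] /andP[s0 s1]; first by left; rewrite scaler0.
  have [->|sn0] := eqVneq s 0; first by left; rewrite scale0r.
  have s_gt0 : 0 < s by rewrite lt_neqAle eq_sym sn0.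
  right; split; first by rewrite scaler_eq0 negb_or sn0.
  change (S (s *: x) <= 1); rewrite SZ// mulr_ile1 ?powR_ge0 ?(ltW (S_gt0 x0))//.
  by rewrite -[leRHS]p1 ge0_ler_powR ?nnegrE// ltW.
- move=> x x0; split; first by rewrite radial_sum// powR_gt0// S_gt0.
  have cx : {for x, continuous (fun y => S y `^ (- p^-1))}.
    apply: (@continuous_comp _ _ _ S (@powR R ^~ (- p^-1))).
      exact: S_continuous.
    apply/differentiable_continuous/derivable1_diffP/derivable_powR.
    by rewrite in_itv/= andbT S_gt0.
  suff : radial (dual_Lp_sum p K t L) y @[y --> x] -->
    radial (dual_Lp_sum p K t L) x by [].
  rewrite radial_sum//; apply: cvg_trans cx.
  apply: (near_eq_cvg (F := nbhs x)).
  near=> y; rewrite radial_sum//.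
  by near: y; exact: neq0_nbhs.
Unshelve. all: by end_near. Qed.

End dual_Lp_sum_star_body.

Definition dual_mixed_volume p K L : R :=
  - (p / n%:R) *
  lim ((volume (dual_Lp_sum p K t L) - volume K) / t @[t --> 0^'+]).

(* For [f >= 0], the function phi with values in ]-oo, +oo] such that
   [f = exp (- phi)], where phi is +oo at the zeros of [f]. *)
Definition neg_log f (x : 'rV[R]_n) : \bar R := (- lne (f x)%:E)%E.

Definition exp_neg (phi : 'rV[R]_n -> \bar R) (x : 'rV[R]_n) : R :=
  fine (expeR (- phi x)%E).

Definition deltaJ_quotient f g t : R :=
  (J (exp_neg (fun x => neg_log f x + t%:E * neg_log g x)%E) - J f) / t.

Definition deltaJ f g : R := - lim (deltaJ_quotient f g t @[t --> 0^'+]).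

End star_bodies.

Definition Gamma (R : realType) (s : R) : R :=
  \int[lebesgue_measure]_(x in `]0, +oo[) (x `^ (s - 1) * expR (- x)).

(* Main.v *)
(* Let phi = mink_K^p and psi = mink_L^p. The sublevel set [phi <= s] is the
   dilate of K by s^(1/p), of volume s^(n/p) V(K); writing
   exp (- phi x) = \int_(phi x)^oo exp (- s) ds and exchanging the integrals gives
   J(f) = V(K) \int_0^oo s^(n/p) exp (- s) ds = Gamma(1 + n/p) V(K).
   Since phi + t psi is the p-th power of the gauge of K_t := K +_p t.L, the same
   formula turns the difference quotient of J into Gamma(1 + n/p) times that of
   V(K_t). As t -> 0+ it converges: it is nondecreasing in t, because
   t |-> exp (- t psi) is convex, and it is bounded below, because psi <= D phi
   gives [phi <= 1/(1 + D t)] \subset K_t and so V(K_t) >= (1 + D t)^(-n/p) V(K). *)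
Require Import Defs.
From HB Require Import structures.
From mathcomp Require Import all_boot all_order all_algebra.
From mathcomp Require Import all_classical all_reals all_analysis.
From mathcomp Require Import measurable_realfun ring lra.
Set Implicit Arguments.
Unset Strict Implicit.
Unset Printing Implicit Defensive.
Import Order.TTheory GRing.Theory Num.Theory.
Import numFieldNormedType.Exports.
Local Open Scope classical_set_scope.
Local Open Scope ring_scope.

(** * Behaviour of Lebesgue measure under dilations *)

(** [c] times the image of Lebesgue measure under multiplication by [c] gives each interval []a, b]]
    the mass [b - a], so it is Lebesgue measure by uniqueness. *)
Lemma lebesgue_measure_preimageZ (R : realType) (c : R) (A : set R) :
  0 < c -> measurable A ->
  lebesgue_measure ((fun x => c * x) @^-1` A) =
  (c^-1%:E * lebesgue_measure A)%E.
Proof.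
move=> c0 mA.
have mc : measurable_fun setT ((fun x => c * x) : measurableTypeR R -> measurableTypeR R).
  exact: measurable_funM.
pose mu : {measure set (measurableTypeR R) -> \bar R} := lebesgue_measure.
have @m0 : {measure set (measurableTypeR R) -> \bar R}.
  by unshelve refine (pushforward mu ((fun x => c * x) : _ -> measurableTypeR R)).
pose m := mscale (NngNum (ltW c0)) m0.
have -> : lebesgue_measure A = m A.
  apply: lebesgue_measure_unique => //= _ [[a b]] _ <-.
  rewrite /m /mscale /m0 /= /pushforward.
  rewrite (_ : _ @^-1` _ = `]c^-1 * a, c^-1 * b]%classic); last first.
    apply/seteqP; split => x /=; rewrite !in_itv/=;
      by rewrite ltr_pdivrMl// ler_pdivlMl.
  rewrite /mu !lebesgue_measure_itv/= !lte_fin ltr_pM2l ?invr_gt0//.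
  case: ifPn => _; last by rewrite mule0.
  by rewrite -!EFinD -EFinM mulrBr !mulVKf ?gt_eqF.
by rewrite /m /mscale /m0 /= /pushforward muleA -EFinM mulVf ?gt_eqF// mul1e.
Qed.

Lemma measurable_scale_rV (R : realType) (n : nat) (c : R) :
  measurable_fun setT ((fun x : 'rV[R]_n => c *: x) : borel_rV R n -> borel_rV R n).
Proof.
apply: measurable_fun_rV => i.
under eq_fun do rewrite mxE.
apply: measurable_funM => //.
by apply: continuous_measurable_rV; exact: coord_continuous.
Qed.

(** Induction on [n] through sections: the new coordinate contributes one factor [c^-1] by the
    one-dimensional case. In the remaining integral, [v] is replaced by [c *: v], and the induction
    hypothesis says that the image of the measure under this map is [c^-1 ^+ n] times the
    measure. *)
Lemma lebesgue_rV_preimageZ (R : realType) (n : nat) (c : R)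
    (A : set (borel_rV R n)) :
  0 < c -> measurable A ->
  lebesgue_rV R n ((fun x : 'rV[R]_n => c *: x) @^-1` A) =
  ((c^-1 ^+ n)%:E * lebesgue_rV R n A)%E.
Proof.
move=> c0; elim: n A => [|n IH] A mA.
  rewrite expr0 mul1e /= !diracE; congr ((nat_of_bool _)%:R%:E).
  by apply/idP/idP; rewrite !inE /= scaler0.
rewrite /= /cons_measure /pushforward.
pose mu := lebesgue_rV R n.
pose B : set (borel_rV R n * measurableTypeR R) := @cons_rV R n @^-1` A.
have mB : measurable B.
  by rewrite -[X in measurable X]setTI; exact: measurable_cons_rV.
pose s : borel_rV R n -> borel_rV R n := fun x : 'rV[R]_n => c *: x.
have ms : measurable_fun setT s by exact: measurable_scale_rV.
have mxB : measurable_fun setT (lebesgue_measure \o xsection B).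
  exact: measurable_fun_xsection.
transitivity (\int[mu]_v (c^-1%:E * lebesgue_measure (xsection B (s v))))%E.
  apply: eq_integral => v _ /=.
  rewrite -lebesgue_measure_preimageZ//; last exact: measurable_xsection.
  congr (lebesgue_measure _); apply/seteqP.
  have E r : c *: (cons_rV (v, r) : 'rV[R]_n.+1) = cons_rV (s v, c * r).
    apply/rowP => i; rewrite mxE.
    by case: (unliftP ord0 i) => [k ->|->]; rewrite ?cons_rVS ?cons_rV0 ?mxE.
  by split => r; rewrite /xsection /= !inE /= /B /= E.
rewrite ge0_integralZl//; last by rewrite lee_fin invr_ge0 ltW.
  2: exact: (measurableT_comp mxB ms).
rewrite exprS EFinM -muleA; congr (_ * _)%E.
have := ge0_integral_pushforward ms mu measurableT mxB.
rewrite preimage_setT => <-//.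
have ck : 0 <= c^-1 ^+ n by rewrite exprn_ge0// invr_ge0 ltW.
rewrite (eq_measure_integral (mscale (NngNum ck) mu)); last first.
  by move=> D mD _; exact: IH.
by rewrite ge0_integral_mscale.
Qed.

(** * Cubes and sigma-finiteness *)

(** This is the closed ball of radius [b] for the sup norm when [0 <= b], written coordinatewise so
    that [lebesgue_rV_box] gives its volume. *)
Definition cube_rV (R : realType) (n : nat) (b : R) : set (borel_rV R n) :=
  [set v | forall i, `[- b, b]%classic ((v : 'rV[R]_n) ord0 i)].

Lemma cube_rVP (R : realType) (n : nat) (b : R) (x : 'rV[R]_n) :
  `|x| <= b -> cube_rV b x.
Proof.
move=> xb i; rewrite /= in_itv/= -ler_norml.
by apply: le_trans xb; rewrite [leRHS]mx_normrE; exact: (le_bigmax _ _ (ord0, i)).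
Qed.

Lemma measurable_cube_rV (R : realType) (n : nat) (b : R) :
  measurable (@cube_rV R n b).
Proof.
rewrite (_ : cube_rV b = \bigcap_(i in [set: 'I_n])
    ((fun v : borel_rV R n => (v : 'rV[R]_n) ord0 i) @^-1` `[- b, b]%classic)).
  apply: fin_bigcap_measurable => // i _.
  rewrite -[X in measurable X]setTI; apply: continuous_measurable_rV => //.
  exact: coord_continuous.
by apply/seteqP; split => [v vA i _|v vA i]; exact: vA.
Qed.

Lemma lebesgue_rV_cube_lty (R : realType) (n : nat) (b : R) :
  (lebesgue_rV R n (cube_rV b) < +oo)%E.
Proof.
rewrite (@lebesgue_rV_box _ _ (fun=> `[- b, b]%classic))//.
rewrite ltey_eq; apply/orP; left.
apply: (big_ind (fun x => x \is a fin_num)) => //.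
  by move=> x y; exact: fin_numM.
by move=> i _; rewrite lebesgue_measure_itv/=; case: ifP.
Qed.

(** This is what allows the integrals over [x] and over the level [s] to be exchanged later. *)
Lemma sigma_finite_lebesgue_rV (R : realType) (n : nat) :
  sigma_finite setT (lebesgue_rV R n).
Proof.
exists (fun k => cube_rV k%:R).
  apply/seteqP; split=> // v _.
  by exists (Num.truncn `|v : 'rV[R]_n|).+1 => //; apply/cube_rVP/ltW/truncnS_gt.
by move=> k; split; [exact: measurable_cube_rV|exact: lebesgue_rV_cube_lty].
Qed.

(** * Gauges and volumes of star bodies *)

Section minkowski.
Context (R : realType) (n : nat).
Implicit Types (M K L : set 'rV[R]_n) (x : 'rV[R]_n).
Local Notation mink := (@minkowski_functional R n).

Lemma radial_gt0 M x : star_body M -> x != 0 -> 0 < radial M x.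
Proof. by move=> [_ _ rM] /rM[]. Qed.

Lemma radialZ M x c : star_body M -> x != 0 -> 0 < c ->
  radial M (c *: x) = radial M x / c.
Proof.
move=> sM x0 c0; apply: radial_eq => [|s s0].
  by rewrite divr_ge0 ?ltW// radial_gt0.
by rewrite scalerA ler_pdivlMr//; apply: radialP => //; rewrite mulr_ge0// ltW.
Qed.

Lemma minkowski_functional0 M : mink M 0 = 0.
Proof. by rewrite /minkowski_functional eqxx. Qed.

Lemma minkowski_functional_ge0 M x : star_body M -> 0 <= mink M x.
Proof.
move=> sM; rewrite /minkowski_functional; case: ifPn => // x0.
by rewrite invr_ge0 ltW// radial_gt0.
Qed.

(** In dimension 0 the empty set satisfies [star_body], whence the assumption on [n]; otherwise a
    nonzero direction has a positive radius, and its multiple by 0 lies in [M]. *)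
Lemma star_body0 M : star_body M -> (0 < n)%N -> M 0.
Proof.
move=> sM n0; have [y y0] : exists y : 'rV[R]_n, y != 0.
  exists (const_mx 1); apply/eqP => /rowP /(_ (Ordinal n0)).
  by rewrite !mxE => /eqP; rewrite oner_eq0.
by rewrite -(scale0r y); apply/(radialP sM y0 (lexx 0)); rewrite ltW// radial_gt0.
Qed.

Lemma minkowski_functional_le M x s : star_body M -> (0 < n)%N -> 0 < s ->
  M (s^-1 *: x) <-> mink M x <= s.
Proof.
move=> sM n0 s0; rewrite /minkowski_functional.
have [->|x0] := eqVneq x 0.
  by rewrite scaler0 (ltW s0); split => // _; exact: star_body0.
rewrite -[leRHS]invrK lef_pV2 ?posrE ?invr_gt0 ?radial_gt0//.
by apply: radialP; rewrite ?invr_ge0 ?ltW.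
Qed.

Lemma measurable_star_body M : star_body M -> measurable (M : set (borel_rV R n)).
Proof.
move=> [cM _ _].
have clM : closed M by apply: compact_closed => //; exact: norm_hausdorff.
rewrite -[X in measurable X]setCK; apply: measurableC.
by apply: sub_gen_smallest; exact: closed_openC.
Qed.

Lemma star_body_volume_lty M : star_body M -> (lebesgue_rV R n M < +oo)%E.
Proof.
move=> sM; have [cM _ _] := sM.
have [B [_ hB]] := compact_bounded cM.
pose b := B + 1.
have {}hB x : M x -> `|x| <= b by apply: hB; rewrite ltr_pwDr.
apply: le_lt_trans (lebesgue_rV_cube_lty n b).
apply: le_measure; rewrite ?inE; [exact: measurable_star_body|exact: measurable_cube_rV|].
by move=> x /hB; exact: cube_rVP.
Qed.

Lemma lebesgue_rV_sublevel M s p : star_body M -> (0 < n)%N -> 0 < p -> 0 < s ->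
  lebesgue_rV R n [set x | mink M x `^ p <= s] =
  ((s `^ (n%:R / p))%:E * lebesgue_rV R n M)%E.
Proof.
move=> sM n0 p0 s0.
have sp0 : 0 < s `^ p^-1 by rewrite powR_gt0.
rewrite (_ : mkset _ = (fun x : 'rV[R]_n => (s `^ p^-1)^-1 *: x) @^-1` M); last first.
  have E x : (mink M x `^ p <= s) = (mink M x <= s `^ p^-1).
    rewrite -[RHS](le_mono_in (gt0_ltr_powR p0)) ?nnegrE ?powR_ge0//.
      by rewrite -powRrM mulVf ?gt_eqF// powRr1// ltW.
    exact: minkowski_functional_ge0.
  by apply/seteqP; split => x; rewrite /= E; move/(minkowski_functional_le x sM n0 sp0).
rewrite lebesgue_rV_preimageZ ?invr_gt0//; last exact: measurable_star_body.
by rewrite invrK -powR_mulrn ?powR_ge0// -powRrM (mulrC p^-1).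
Qed.

(** By compactness the gauge of [L] is at most some [m] on the unit sphere, and [K] lies in a ball
    of radius [b], so the gauge of [K] is at least [1 / b] there. Homogeneity then gives the
    constant [m * b]. *)
Lemma minkowski_functional_leZ K L : star_body K -> star_body L ->
  exists2 C, 0 < C & forall x, mink L x <= C * mink K x.
Proof.
move=> sK sL; have [cK _ _] := sK.
have [B [_ hB]] := compact_bounded cK.
(* The maximum with 1 makes [b] positive without a case distinction on whether [K] is empty. *)
pose b := Num.max (B + 1) 1.
have b0 : 0 < b by rewrite lt_max ltr01 orbT.
have {}hB x : K x -> `|x| <= b by apply: hB; rewrite lt_max ltr_pwDr.
pose S := [set x : 'rV[R]_n | `|x| = 1].
have S0 x : S x -> x != 0 by rewrite /S /= -normr_gt0 => ->.
have cS : compact S.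
  apply: bounded_closed_compact.
    by exists 1; split => // y y1 x /= ->; exact: ltW.
  rewrite (_ : S = (fun x : 'rV[R]_n => `|x|) @^-1` [set 1])//.
  by apply: preimage_closed => // x _; exact: norm_continuous.
have [m m0 Lm] : exists2 m, 0 < m & forall x, S x -> (radial L x)^-1 <= m.
  have /compact_bounded[m [_ hm]] : compact ((fun x => (radial L x)^-1) @` S).
    apply: continuous_compact => //; apply: continuous_in_subspaceT => x.
    rewrite inE => /S0 x0; apply: continuousV; first by rewrite gt_eqF// radial_gt0.
    by case: sL => _ _ /(_ _ x0)[].
  exists (Num.max (m + 1) 1); first by rewrite lt_max ltr01 orbT.
  move=> x Sx; apply: le_trans (ler_norm _) _; apply: hm; last by exists x.
  by rewrite lt_max ltr_pwDr.
exists (m * b); first by rewrite mulr_gt0.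
move=> x; rewrite /minkowski_functional; case: ifPn => [_|x0]; first by rewrite mulr0.
have nx0 : 0 < `|x| by rewrite normr_gt0.
have Sx : S (`|x|^-1 *: x) by rewrite /S /= normrZ normfV normr_id mulVf ?gt_eqF.
have := Lm _ Sx; rewrite radialZ ?invr_gt0// invrK invfM.
rewrite ler_pdivrMr// => /le_trans; apply; rewrite -mulrA ler_pM2l//.
rewrite ler_pdivlMr ?radial_gt0//.
(* The boundary point of [K] in the direction of [x] has norm at most [b]. *)
have : K (radial K x *: x) by apply/(radialP sK x0) => //; rewrite ltW// radial_gt0.
by move/hB; rewrite normrZ gtr0_norm ?radial_gt0// mulrC.
Qed.

End minkowski.

(** * Layer-cake formula and the Gamma integral *)

Lemma integral_expRN (R : realType) (r : R) :
  (\int[lebesgue_measure]_(s in `[r, +oo[) (expR (- s))%:E = (expR (- r))%:E)%E.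
Proof.
have cE : continuous (fun s : R => expR (- s)).
  move=> s; apply: (@continuous_comp _ _ _ -%R expR).
    exact: opp_continuous.
  exact: continuous_expR.
have dE (x : R) : is_derive x 1 (fun s => - expR (- s)) (expR (- x)).
  apply: is_derive_eq.
  by rewrite mulrN1 opprK.
rewrite (@ge0_continuous_FTC2y _ (fun s => expR (- s)) (fun s => - expR (- s)) _ 0).
- by rewrite EFinN oppeK add0e.
- by move=> x _; exact: expR_ge0.
- exact: continuous_subspaceT.
- by rewrite -oppr0; apply: cvgN; exact: cvgr_expR.
- by move=> x _; exact: ex_derive.
- by apply/cvg_at_right_filter; apply: cvgN; exact: cE.
- by move=> x _; rewrite derive1E derive_val.
Qed.

Lemma integral_expRN_sublevel d (T : measurableType d) (R : realType)
    (mu : {sigma_finite_measure set T -> \bar R}) (phi : T -> R) :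
  measurable_fun setT phi -> (forall x, 0 <= phi x) ->
  (\int[mu]_x (expR (- phi x))%:E =
   \int[lebesgue_measure]_(s in `]0%R, +oo[)
     ((expR (- s))%:E * mu [set x | phi x <= s]%R))%E.
Proof.
move=> mphi phi0.
pose A : set (T * measurableTypeR R) := [set z | 0 < z.2 /\ phi z.1 <= z.2].
have mE : measurable_fun setT (fun s : measurableTypeR R => expR (- s)).
  by apply: measurableT_comp.
have mA : measurable A.
  rewrite (_ : A = ((fun z : T * measurableTypeR R => 0 < z.2 :> R) @^-1` [set true]) `&`
      ((fun z : T * measurableTypeR R => phi z.1 <= z.2 :> R) @^-1` [set true])); last first.
    by apply/seteqP; split.
  apply: measurableI; rewrite -[X in measurable X]setTI.
    have : measurable_fun setT (fun z : T * measurableTypeR R => 0 < z.2 :> R).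
      by apply: measurable_fun_ltr.
    exact.
  have : measurable_fun setT (fun z : T * measurableTypeR R => phi z.1 <= z.2 :> R).
    by apply: measurable_fun_ler => //; apply: measurableT_comp.
  exact.
pose F (z : T * measurableTypeR R) : \bar R := (expR (- z.2) * \1_A z)%:E.
have mF : measurable_fun setT F.
  apply/measurable_EFinP; apply: measurable_funM => //.
  exact: (measurableT_comp mE measurable_snd).
have F0 z : (0 <= F z)%E by rewrite lee_fin mulr_ge0// expR_ge0.
transitivity (\int[mu]_x \int[lebesgue_measure]_s F (x, s))%E.
  apply: eq_integral => x _.
  have -> : (expR (- phi x))%:E =
      (\int[lebesgue_measure]_(s in `[phi x, +oo[%classic `&` `]0%R, +oo[%classic)
        (expR (- s))%:E)%E.
    (* If [phi x = 0], the half-lines [[phi x, +oo[] and []0, +oo[] differ by the null set [{0}]; if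
       [phi x > 0], the first lies in the second. *)
    have := phi0 x; rewrite le_eqVlt => /predU1P[<-|x0].
      rewrite setIidr; last by apply: subset_itvr; rewrite bnd_simp.
      rewrite integral_itv_obnd_cbnd ?integral_expRN//.
      by apply/measurable_EFinP/measurable_funTS.
    rewrite setIidl ?integral_expRN//.
    by apply: subset_itvr; rewrite bnd_simp.
  rewrite integral_mkcond; apply: eq_integral => s _.
  rewrite /F patchE indicE.
  have -> : (s \in `[phi x, +oo[%classic `&` `]0, +oo[%classic) = ((x, s) \in A).
    apply/idP/idP; rewrite !inE /A /= !in_itv/= !andbT => -[]; tauto.
  by case: ifPn => _; rewrite ?mulr1 ?mulr0.
rewrite (@sfinite_Fubini _ _ _ _ _ mu (@lebesgue_measure R) F F0 mF).
rewrite [RHS]integral_mkcond; apply: eq_integral => s _; rewrite patchE.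
have mS : measurable [set x | phi x <= s].
  rewrite -[X in measurable X]setTI.
  rewrite (_ : [set x | _] = phi @^-1` `]-oo, s]%classic); first exact: mphi.
  by apply/seteqP; split => x; rewrite /= in_itv.
have [s0|s0] := boolP (s \in `]0, +oo[%classic).
  rewrite -[in RHS](setIT [set x | phi x <= s]) -integral_indic//.
  rewrite -ge0_integralZl//; last exact/measurable_EFinP.
  apply: eq_integral => x _; rewrite /F -EFinM !indicE; congr ((_ * _ %:R)%:E).
  rewrite inE /= in_itv/= andbT in s0.
  by congr nat_of_bool; apply/idP/idP; rewrite !inE /A /= => ?; tauto.
rewrite integral0_eq// => x _; rewrite /F indicE memNset ?mulr0//.
by rewrite /A /= => -[s1 _]; move/negP: s0; rewrite inE /= in_itv/= s1.
Qed.

Lemma integral_powR_expRN_lty (R : realType) (a : R) : 0 < a ->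
  (\int[lebesgue_measure]_(s in `]0%R, +oo[) (s `^ a * expR (- s))%:E < +oo)%E.
Proof.
move=> a0; pose C := expR (a * ln (2 * a)).
have bnd s : 0 < s -> s `^ a * expR (- s) <= 2 * C * exponential_pdf 2^-1 s.
  move=> s0; rewrite (exponential_pdfE _ (ltW s0))//.
  rewrite (_ : 2 * C * _ = C * expR (- (2^-1 * s))); last by rewrite mulNr; field.
  rewrite /powR (gt_eqF s0) /C -!expRD ler_expR.
  have a2 : 0 < 2 * a by rewrite mulr_gt0.
  have h : ln (s / (2 * a)) <= s / (2 * a) - 1.
    rewrite -[X in ln X](subrK 1) addrC.
    by apply: le_ln1Dx; rewrite ltrBrDl subrr divr_gt0.
  have -> : ln s = ln (2 * a) + ln (s / (2 * a)).
    by rewrite -lnM ?posrE ?divr_gt0// mulrC divfK// gt_eqF.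
  have := ler_wpM2l (ltW a0) h.
  rewrite (_ : a * (s / (2 * a) - 1) = s / 2 - a); first by move=> h'; lra.
  by field; rewrite gt_eqF.
have mf : measurable_fun setT (fun s : measurableTypeR R => s `^ a * expR (- s)).
  apply: measurable_funM; first exact: measurable_powR.
  exact: measurableT_comp.
have C0 : 0 < 2 * C by rewrite mulr_gt0// expR_gt0.
pose g (s : R) := ((2 * C)%:E * (exponential_pdf 2^-1 s)%:E)%E.
have mpdf : measurable_fun setT (fun s : R => (exponential_pdf 2^-1 s)%:E).
  by apply/measurable_EFinP; exact: measurable_exponential_pdf.
have mg : measurable_fun setT g by exact: emeasurable_funM.
have g0 s : (0 <= g s)%E.
  by rewrite mule_ge0// lee_fin ?(ltW C0)// exponential_pdf_ge0// invr_ge0.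
apply: (@le_lt_trans _ _ (\int[lebesgue_measure]_(s in `]0%R, +oo[) g s)%E).
  apply: ge0_le_integral => //.
  - by move=> s _; rewrite lee_fin mulr_ge0 ?powR_ge0 ?expR_ge0.
  - exact/measurable_EFinP/measurable_funTS.
  - exact: measurable_funTS.
  - by move=> s /=; rewrite in_itv/= andbT => s0; rewrite lee_fin bnd.
apply: (@le_lt_trans _ _ (\int[lebesgue_measure]_s g s)%E).
  exact: ge0_subset_integral.
rewrite ge0_integralZl//; last by rewrite lee_fin ltW.
- by rewrite integral_exponential_pdf ?invr_gt0// mule1 ltry.
- by move=> s _; rewrite lee_fin exponential_pdf_ge0// invr_ge0.
Qed.

(** [Gamma] is a real-valued integral, which would be 0 on divergence; finiteness makes it agree
    with the extended one. *)
Lemma integral_powR_expRN (R : realType) (a : R) : 0 < a ->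
  (\int[lebesgue_measure]_(s in `]0%R, +oo[) (s `^ a * expR (- s))%:E =
   (Gamma (1 + a))%:E)%E.
Proof.
move=> a0; rewrite /Gamma addrAC subrr add0r /Rintegral fineK//.
rewrite ge0_fin_numE ?integral_powR_expRN_lty//.
by apply: integral_ge0 => s _; rewrite lee_fin mulr_ge0 ?powR_ge0 ?expR_ge0.
Qed.

Lemma Gamma_ge0 (R : realType) (a : R) : 0 <= Gamma a.
Proof.
by apply: Rintegral_ge0 => s _; rewrite mulr_ge0 ?powR_ge0 ?expR_ge0.
Qed.

(** * The functional [J] on exponentials of gauges *)

Section gauge_integral.
Context (R : realType) (n : nat).
Hypothesis n_gt0 : (0 < n)%N.
Variable p : R.
Hypothesis p_gt0 : 0 < p.
Local Notation mink := (@minkowski_functional R n).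

Lemma minkowski_functional_eq0 M x : star_body M -> mink M x = 0 -> x = 0.
Proof.
move=> sM; rewrite /minkowski_functional; case: eqP => // /eqP x0 /eqP.
by rewrite invr_eq0 gt_eqF// radial_gt0.
Qed.

Lemma measurable_minkowski_functional M : star_body M ->
  measurable_fun setT (mink M : borel_rV R n -> R).
Proof.
move=> sM.
apply: (@measurability _ _ (borel_rV R n) R setT (mink M) _ (RGenOInfty.measurableE R)).
move=> _ [_ [s ->] <-]; rewrite setTI.
rewrite (_ : _ @^-1` _ = ~` [set x | mink M x <= s]); last first.
  by apply/seteqP; split => x; rewrite /= in_itv/= andbT ltNge => /negP.
(* The sublevel set is a dilate of [M] for [s > 0], empty for [s < 0], and the origin alone for
   [s = 0]. *)
apply: measurableC; have [s0|s0|<-] := ltgtP 0 s.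
- rewrite (_ : mkset _ = (fun x : 'rV[R]_n => s^-1 *: x) @^-1` M); last first.
    by apply/seteqP; split => x /=; move/(minkowski_functional_le x sM n_gt0 s0).
  rewrite -[X in measurable X]setTI.
  by apply: (measurable_scale_rV (n := n) s^-1) => //; exact: measurable_star_body.
- rewrite (_ : mkset _ = set0)//; apply/seteqP; split => // x /= /le_lt_trans /(_ s0).
  by rewrite ltNge minkowski_functional_ge0.
- rewrite (_ : mkset _ = [set 0]).
    rewrite -[X in measurable X]setCK; apply: measurableC.
    apply: sub_gen_smallest; apply: closed_openC.
    by apply: accessible_closed_set1; apply: hausdorff_accessible; exact: norm_hausdorff.
  apply/seteqP; split => x /= => [xM|->]; last by rewrite minkowski_functional0.
  apply: (@minkowski_functional_eq0 M) => //; apply/eqP.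
  by rewrite eq_le xM minkowski_functional_ge0.
Qed.

Lemma measurable_minkowski_functional_powR M : star_body M ->
  measurable_fun setT (fun x : borel_rV R n => mink M x `^ p).
Proof.
move=> sM; apply: (measurableT_comp (measurable_powR p)).
exact: measurable_minkowski_functional.
Qed.

Lemma integral_expRN_minkowski M : star_body M ->
  (\int[lebesgue_rV R n]_x (expR (- mink M x `^ p))%:E =
   (Gamma (1 + n%:R / p))%:E * lebesgue_rV R n M)%E.
Proof.
move=> sM.
have sf := @sigma_finite_lebesgue_rV R n.
pose mu : {sigma_finite_measure set (borel_rV R n) -> \bar R} :=
  HB.pack (lebesgue_rV R n : set _ -> \bar R)
   (Measure.class (lebesgue_rV R n))
   (isSigmaFinite.Build _ _ _ (lebesgue_rV R n : set _ -> \bar R) sf)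
   (isSFinite.Build _ _ _ (lebesgue_rV R n : set _ -> \bar R)
     (sfinite_measure_sigma_finite sf)).
have mphi := measurable_minkowski_functional_powR sM.
transitivity (\int[lebesgue_measure]_(s in `]0%R, +oo[)
     ((expR (- s))%:E * lebesgue_rV R n [set x | mink M x `^ p <= s]%R))%E.
  apply: (@integral_expRN_sublevel _ _ _ mu) => // x.
  exact: powR_ge0.
have mf : measurable_fun setT
    (fun s : measurableTypeR R => (s `^ (n%:R / p) * expR (- s))%:E).
  apply/measurable_EFinP; apply: measurable_funM; first exact: measurable_powR.
  exact: measurableT_comp.
rewrite -integral_powR_expRN ?divr_gt0 ?ltr0n// muleC -ge0_integralZl//; last 2 first.
- exact: measurable_funTS.
- by move=> s _; rewrite lee_fin mulr_ge0 ?powR_ge0 ?expR_ge0.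
apply: eq_integral => s; rewrite inE /= in_itv/= andbT => s0.
rewrite lebesgue_rV_sublevel// EFinM muleC [RHS]muleA.
by rewrite [in RHS](muleC (lebesgue_rV R n M)).
Qed.

Lemma volumeE M : star_body M -> ((volume M)%:E = lebesgue_rV R n M)%E.
Proof.
by move=> sM; rewrite /volume fineK// ge0_fin_numE// star_body_volume_lty.
Qed.

Lemma J_expRN_minkowski M : star_body M ->
  J (fun x => expR (- mink M x `^ p)) = Gamma (1 + n%:R / p) * volume M.
Proof.
by move=> sM; rewrite /J /Rintegral integral_expRN_minkowski// -volumeE.
Qed.

Lemma integrable_expRN_minkowski M : star_body M ->
  (lebesgue_rV R n).-integrable setT (fun x => (expR (- mink M x `^ p))%:E).
Proof.
move=> sM; have mphi := measurable_minkowski_functional_powR sM.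
apply/integrableP; split.
  by apply/measurable_EFinP; do 2 apply: measurableT_comp => //.
under eq_integral do rewrite gee0_abs ?lee_fin ?expR_ge0//.
by rewrite integral_expRN_minkowski// -volumeE// ltry.
Qed.

End gauge_integral.

(** * Convexity inequalities *)

(* The tangent of [expR] at [- (l * y)] lies below [expR] at [0] and at [- y]. *)
Lemma expRN_convex (R : realType) (l y : R) : 0 <= l <= 1 ->
  expR (- (l * y)) <= (1 - l) + l * expR (- y).
Proof.
move=> /andP[l0 l1]; set E := expR (- (l * y)).
have E0 : 0 <= E by exact: expR_ge0.
have h0 : E * (1 + l * y) <= 1.
  by apply: (le_trans (ler_wpM2l E0 (expR_ge1Dx _))); rewrite -expRD addNr expR0.
have h1 : E * (1 + (l * y - y)) <= expR (- y).
  by apply: (le_trans (ler_wpM2l E0 (expR_ge1Dx _))); rewrite -expRD addKr.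
have l1' : 0 <= 1 - l by rewrite subr_ge0.
have := lerD (ler_wpM2l l1' h0) (ler_wpM2l l0 h1).
rewrite mulr1; apply: le_trans.
by rewrite le_eqVlt; apply/orP; left; apply/eqP; ring.
Qed.

(** For a convex function with values [y], [x], [z] at 0, [s], [t], the hypothesis is convexity at
    [s = (s / t) * t]; the conclusion compares chord slopes from 0. *)
Lemma slope_le (R : realType) (s t x y z : R) : 0 < s -> s <= t ->
  x <= (1 - s / t) * y + s / t * z -> (x - y) / s <= (z - y) / t.
Proof.
move=> s0 st h; have t0 := lt_le_trans s0 st.
rewrite ler_pdivrMr// mulrAC -mulrA lerBlDl; apply: le_trans h _.
by rewrite le_eqVlt; apply/orP; left; apply/eqP; ring.
Qed.

Lemma Rintegral_le_conv d (T : measurableType d) (R : realType)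
    (mu : {measure set T -> \bar R}) (l : R) (f g h : T -> R) :
  mu.-integrable setT (EFin \o f) -> mu.-integrable setT (EFin \o g) ->
  mu.-integrable setT (EFin \o h) ->
  (forall x, f x <= (1 - l) * g x + l * h x) ->
  \int[mu]_x f x <= (1 - l) * \int[mu]_x g x + l * \int[mu]_x h x.
Proof.
move=> intf intg inth fgh.
have int1 : mu.-integrable setT (fun x => ((1 - l) * g x)%:E).
  exact: (integrableZl measurableT (1 - l) intg).
have int2 : mu.-integrable setT (fun x => (l * h x)%:E).
  exact: (integrableZl measurableT l inth).
rewrite -(RintegralZl _ measurableT intg) -(RintegralZl _ measurableT inth).
rewrite -(RintegralD measurableT int1 int2).
apply: (le_Rintegral measurableT intf) => [|x _]; last exact: fgh.
exact: (integrableD measurableT int1 int2).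
Qed.

(** * Monotonicity and lower bound for the volume quotient *)

Section dual_Lp_variation.
Context (R : realType) (n : nat) (p : R) (K L : set 'rV[R]_n).
Hypotheses (n_gt0 : (0 < n)%N) (p_ge1 : 1 <= p).
Hypotheses (starK : star_body K) (starL : star_body L).
Local Notation mink := (@minkowski_functional R n).
Local Notation Kt t := (dual_Lp_sum p K t L).
Local Notation G := (Gamma (1 + n%:R / p)).
Local Notation a := (n%:R / p).

Let p_gt0 : 0 < p. Proof. exact: lt_le_trans p_ge1. Qed.

Lemma minkowski_functional_powR M x : star_body M -> x != 0 ->
  mink M x `^ p = radial M x `^ (- p).
Proof.
move=> sM x0; rewrite /minkowski_functional (negPf x0).
by rewrite -powR_inv1 ?ltW ?radial_gt0// -powRrM mulN1r.
Qed.

(** The perturbed exponent is thus again the [p]-th power of the gauge of a star body, so the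
    formula for [J] applies to it. *)
Lemma minkowski_dual_Lp_sum t x : 0 <= t ->
  mink (Kt t) x `^ p = mink K x `^ p + t * mink L x `^ p.
Proof.
move=> t0; have [->|x0] := eqVneq x 0.
  by rewrite !minkowski_functional0 powR0 ?gt_eqF// mulr0 addr0.
by rewrite !minkowski_functional_powR ?dual_Lp_sum_radial//; exact: dual_Lp_sum_star_body.
Qed.

(** [G * volume (Kt u)] is the integral of the exponential of minus the gauge power of [Kt u]. That
    integrand is convex in [u] at each point, and integration preserves this. *)
Lemma volume_dual_Lp_sum_convex s t : 0 < s -> s <= t ->
  (G * volume (Kt s) - G * volume K) / s <= (G * volume (Kt t) - G * volume K) / t.
Proof.
move=> s0 st; have t0 := lt_le_trans s0 st.
have sKt u : 0 <= u -> star_body (Kt u) by move=> u0; exact: dual_Lp_sum_star_body.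
have ss := sKt _ (ltW s0); have stt := sKt _ (ltW t0).
pose l := s / t.
have l01 : 0 <= l <= 1 by rewrite divr_ge0 ?(ltW s0) ?(ltW t0)//= ler_pdivrMr// mul1r.
have iK := integrable_expRN_minkowski n_gt0 p_gt0 starK.
have iS := integrable_expRN_minkowski n_gt0 p_gt0 ss.
have iT := integrable_expRN_minkowski n_gt0 p_gt0 stt.
have ptw (x : borel_rV R n) : expR (- mink (Kt s) x `^ p) <=
    (1 - l) * expR (- mink K x `^ p) + l * expR (- mink (Kt t) x `^ p).
  rewrite !minkowski_dual_Lp_sum ?(ltW s0) ?(ltW t0)//.
  set A := mink K x `^ p; set B := mink L x `^ p.
  rewrite !opprD !expRD mulrCA -(mulrC (expR (- A))) -mulrDr ler_wpM2l ?expR_ge0//.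
  (* After factoring out [expR (- A)], this is [expRN_convex] at [y = t * B] with weight
     [l = s / t]. *)
  have -> : s * B = l * (t * B) by rewrite mulrA divfK// gt_eqF.
  exact: expRN_convex.
have conv_eq (u v w u' v' w' : R) : u = u' -> v = v' -> w = w' ->
    u <= (1 - l) * v + l * w -> u' <= (1 - l) * v' + l * w'.
  by move=> -> -> ->.
apply: slope_le => //.
exact (conv_eq _ _ _ _ _ _ (J_expRN_minkowski n_gt0 p_gt0 ss)
  (J_expRN_minkowski n_gt0 p_gt0 starK) (J_expRN_minkowski n_gt0 p_gt0 stt)
  (Rintegral_le_conv iS iK iT ptw)).
Qed.

Lemma volume_dual_Lp_sum_lbound : exists2 c, 0 <= c &
  forall t, 0 < t -> - c <= (volume (Kt t) - volume K) / t.
Proof.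
have [C C0 hC] := minkowski_functional_leZ starK starL.
pose D := C `^ p; have D0 : 0 < D by rewrite powR_gt0.
have hD x : mink L x `^ p <= D * mink K x `^ p.
  have mK := minkowski_functional_ge0 x starK.
  rewrite -powRM ?(ltW C0)//; apply: ge0_ler_powR (hC x); first exact: ltW.
    by rewrite nnegrE minkowski_functional_ge0.
  by rewrite nnegrE mulr_ge0// ltW.
have a0 : 0 < a by rewrite divr_gt0// ltr0n.
have V0 : 0 <= volume K by rewrite /volume fine_ge0.
exists (a * D * volume K); first by rewrite mulr_ge0// mulr_ge0// ltW.
move=> t t0; have sT := dual_Lp_sum_star_body starK starL p_ge1 (ltW t0).
have Dt0 : 0 < 1 + D * t by rewrite addr_gt0// mulr_gt0.
have hV : ((1 + D * t)^-1 `^ a) * volume K <= volume (Kt t).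
  rewrite -lee_fin EFinM !volumeE//.
  rewrite -(@lebesgue_rV_sublevel R n K _ p)// ?invr_gt0//.
  apply: le_measure; rewrite ?inE.
  - rewrite (_ : mkset _ = (fun x : borel_rV R n => mink K x `^ p) @^-1`
        `]-oo, (1 + D * t)^-1]%classic); last first.
      by apply/seteqP; split => x; rewrite /= in_itv.
    rewrite -[X in measurable X]setTI.
    exact: measurable_minkowski_functional_powR.
  - exact: measurable_star_body.
  move=> x /= hx; rewrite -[x]scale1r -invr1.
  apply/(minkowski_functional_le _ sT n_gt0 ltr01).
  rewrite -(le_mono_in (gt0_ltr_powR p_gt0)) ?nnegrE ?minkowski_functional_ge0//.
  rewrite powR1 minkowski_dual_Lp_sum ?(ltW t0)//.
  (* The [p]-th power of the gauge of [Kt t] is at most [1 + D * t] times that of [K], hence at most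
     1 on the chosen sublevel set. *)
  apply: (@le_trans _ _ ((1 + D * t) * mink K x `^ p)).
    by rewrite mulrDl mul1r lerD2l (mulrC D) -mulrA ler_pM2l.
  by rewrite -ler_pdivlMl// mulr1.
(* A Bernoulli-type inequality, from [expR z >= 1 + z] and [ln (1 + y) <= y]. *)
have hE : 1 - a * (D * t) <= (1 + D * t)^-1 `^ a.
  rewrite /powR gt_eqF ?invr_gt0// lnV ?posrE//.
  apply: le_trans (expR_ge1Dx _); rewrite lerD2l mulrN lerN2 ler_pM2l//.
  by apply: le_ln1Dx; rewrite (lt_trans (ltrN10 _))// mulr_gt0.
rewrite ler_pdivlMr// lerBrDl; apply: le_trans hV.
have := ler_wpM2r V0 hE; apply: le_trans.
by rewrite le_eqVlt; apply/orP; left; apply/eqP; ring.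
Qed.

End dual_Lp_variation.

(** * Passage to the limit *)

Lemma neg_log_expRN (R : realType) (n : nat) (f : 'rV[R]_n -> R) x y :
  f x = expR (- y) -> neg_log f x = y%:E.
Proof.
by move=> fx; rewrite /neg_log fx lne_EFin ?expR_gt0// expRK EFinN oppeK.
Qed.

(* For [c = 0] the equality holds even if [v] diverges. *)
Lemma lim_near_mull (R : realType) (T : Type) (F : set_system T)
    {FF : ProperFilter F} (c : R) (q v : T -> R) :
  (\forall t \near F, q t = c * v t) -> cvg (q t @[t --> F]) ->
  lim (q t @[t --> F]) = c * lim (v t @[t --> F]).
Proof.
move=> qv cq; have [c0|c0] := eqVneq c 0.
  rewrite c0 mul0r; apply: cvg_lim => //; apply: cvg_near_cst.
  by apply: filterS qv => t ->; rewrite c0 mul0r.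
suff -> : lim (v t @[t --> F]) = c^-1 * lim (q t @[t --> F]) by rewrite mulVKf.
apply: cvg_lim => //.
have : c^-1 * q t @[t --> F] --> c^-1 * lim (q t @[t --> F]) by exact: cvgMr.
apply: cvg_trans; apply: near_eq_cvg.
by apply: filterS qv => t ->; rewrite mulKf.
Qed.

Theorem lemma3p1 (R : realType) (n : nat) (p : R) (K L : set 'rV[R]_n)
    (phi psi f g : 'rV[R]_n -> R)
    (n_gt0 : (0 < n)%N) (p_ge1 : 1 <= p)
    (starK : star_body K) (starL : star_body L)
    (phiE : forall x, phi x = minkowski_functional K x `^ p)
    (psiE : forall x, psi x = minkowski_functional L x `^ p)
    (fE : forall x, f x = expR (- phi x))
    (gE : forall x, g x = expR (- psi x)) :
  [/\ J f = Gamma (1 + n%:R / p) * volume K,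
      cvg (deltaJ_quotient f g t @[t --> 0^'+]) &
      deltaJ f g =
        n%:R / p * Gamma (1 + n%:R / p) * dual_mixed_volume p K L].
Proof.
have p_gt0 : 0 < p by exact: lt_le_trans p_ge1.
set G := Gamma _; pose v t := (volume (dual_Lp_sum p K t L) - volume K) / t.
have Jf : J f = G * volume K.
  rewrite -(J_expRN_minkowski n_gt0 p_gt0 starK); congr J; apply/funext => x.
  by rewrite fE phiE.
have qE t : 0 < t -> deltaJ_quotient f g t = G * v t.
  move=> t0; rewrite /deltaJ_quotient Jf /v mulrA; congr (_ / _).
  rewrite mulrBr; congr (_ - _).
  have sT := dual_Lp_sum_star_body starK starL p_ge1 (ltW t0).
  rewrite -(J_expRN_minkowski n_gt0 p_gt0 sT); congr J; apply/funext => x.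
  (* [f] and [g] are positive everywhere, so both [neg_log] values are finite, namely [phi x] and
     [psi x]. *)
  rewrite /exp_neg (neg_log_expRN (fE x)) (neg_log_expRN (gE x)) /=.
  by rewrite (minkowski_dual_Lp_sum p_ge1 starK starL x (ltW t0)) phiE psiE.
have cq : cvg (deltaJ_quotient f g t @[t --> 0^'+]).
  apply/cvg_ex; eexists.
  (* A function nondecreasing and bounded below on []0, +oo[] has a right limit at 0. *)
  apply: (@nondecreasing_at_right_cvgr _ _ _ +oo%O) => //.
    move=> s t; rewrite !in_itv/= !andbT => s0 t0 st.
    by rewrite !qE// /v !mulrA !mulrBr; exact: volume_dual_Lp_sum_convex.
  have [c c0 hc] := volume_dual_Lp_sum_lbound n_gt0 p_ge1 starK starL.
  exists (- (G * c)) => _ [t /= + <-]; rewrite in_itv/= andbT => t0.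
  by rewrite qE// -mulrN ler_wpM2l ?Gamma_ge0 ?hc.
split => //.
rewrite /deltaJ /dual_mixed_volume -/(v _).
have qv : \forall t \near 0^'+, deltaJ_quotient f g t = G * v t.
  by near=> t; apply: qE.
(* Convergence is known for the quotient of [J]; [G] leaves the limit whether or not it vanishes.
   The factor [- (p / n)] of [dual_mixed_volume] then cancels against [n / p] and the sign in
   [deltaJ]. *)
rewrite (lim_near_mull qv cq).
by field; rewrite pnatr_eq0 -lt0n n_gt0 gt_eqF.
Unshelve. all: by end_near. Qed.
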